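(* Let $k\geq 2$ be an even integer, let $S_k=\{j : j \text{ odd},\ 1\leq j\leq k-1\}$, and let $\ell$ be the least common multiple of the integers in $S_k$. Then for every odd prime $p<k$, every integer $r$ with $1\leq r\leq \mathrm{ord}_p(\ell)$, and every $n\geq1$, \[\overline{pl}_k(\ell n+p^r)\equiv\begin{cases}0\pmod 4 & \text{if } r \text{ is odd},\\ 2\pmod 4 & \text{if } r\text{ is even}.\end{cases}\] Moreover, for all $n\geq 1$, \[\overline{pl}_k(\ell n)\equiv\begin{cases}0\pmod 4 & \text{if } k\equiv 0\pmod 4,\\ 2\pmod 4 & \text{if } k\equiv 2\pmod 4.\end{cases}\]
   Context: A plane overpartition of $n$ is a plane partition of $n$ (an array $(\pi_{ij})_{i,j\geq1}$ of nonnegative integers, weakly decreasing along rows and down columns, with $\sum\pi_{ij}=n$) in which entries may be overlined subject to: in each row, the last occurrence of an integer may be overlined or not and all other occurrences of that integer in the row are not overlined; in each column, the first occurrence of an integer may be overlined or not and all other occurrences of that integer in the column are overlined. A $k$-rowed plane overpartition is a plane overpartition with at most $k$ (nonzero) rows; $\overline{pl}_k(n)$ is their number ($\overline{pl}_k(0)=1$), with generating function $\sum_{n\geq0}\overline{pl}_k(n)q^n=\prod_{n\geq1}\left(\frac{1+q^n}{1-q^n}\right)^{\min\{k,n\}}$. For a prime $p$, $\mathrm{ord}_p(m)$ is the largest nonnegative integer $e$ with $p^e\mid m$. *)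

(* Defs.v *)
From mathcomp Require Import all_boot.
From mathcomp Require Import finmap.
From mathcomp Require Import boolp classical_sets functions cardinality.

Set Implicit Arguments.
Unset Strict Implicit.
Unset Printing Implicit Defensive.

Local Open Scope classical_set_scope.

(* Rows and columns of arrays are numbered from 0. *)

(* Finite support is required explicitly, so that the sum of all the entries  *)
(* is a finite sum over a box containing the support.                         *)
Definition plane_partition (n : nat) (pi : nat -> nat -> nat) : Prop :=
  [/\ forall i j, pi i j.+1 <= pi i j,
      forall i j, pi i.+1 j <= pi i j
    & exists2 B, forall i j, pi i j != 0 -> (i < B) && (j < B)
               & \sum_(i < B) \sum_(j < B) pi i j = n].

(* ov i j means that entry (i, j) is overlined. Only the positive entries are *)
(* parts, hence subject to the rules; the zeros outside the shape carry no    *)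
(* overline.                                                                  *)
Definition overlining (pi : nat -> nat -> nat) (ov : nat -> nat -> bool) :
    Prop :=
  [/\ forall i j, pi i j = 0 -> ~~ ov i j,
      forall i j j', j < j' -> 0 < pi i j -> pi i j' = pi i j -> ~~ ov i j
    & forall i i' j, i < i' -> 0 < pi i j -> pi i' j = pi i j -> ov i' j].

Definition plane_overpartitions (k n : nat) :
    set ((nat -> nat -> nat) * (nat -> nat -> bool)) :=
  [set x | [/\ plane_partition n x.1, overlining x.1 x.2
             & forall i j, k <= i -> x.1 i j = 0]].

(* fset_set is meaningful on finite sets only: see                            *)
(* finite_plane_overpartitions.                                               *)
Definition plbar (k n : nat) : nat := #|` fset_set (plane_overpartitions k n)|.

Definition lcm_odd_below (k : nat) : nat :=
  \big[lcmn/1]_(1 <= j < k | odd j) j.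

Lemma plane_partition_row n pi i j j' :
  plane_partition n pi -> j <= j' -> pi i j' <= pi i j.
Proof.
case=> row _ _ /subnKC <-; elim: (j' - j) => [|d IH]; first by rewrite addn0.
by rewrite addnS (leq_trans (row _ _)).
Qed.

Lemma plane_partition_col n pi i i' j :
  plane_partition n pi -> i <= i' -> pi i' j <= pi i j.
Proof.
case=> _ col _ /subnKC <-; elim: (i' - i) => [|d IH]; first by rewrite addn0.
by rewrite addnS (leq_trans (col _ _)).
Qed.

Lemma plane_partition_bound n pi i j : plane_partition n pi ->
  pi i j != 0 -> [&& i < n, j < n & pi i j <= n].
Proof.
move=> ppi nz; have [_ _ [B supp sumB]] := ppi.
have /andP[iB jB] := supp _ _ nz.
have lt0 : 0 < pi i j by rewrite lt0n.
have count m : m < B -> m.+1 = \sum_(a < B | a < m.+1) 1.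
  by move=> mB; rewrite -(big_ord_widen _ (fun=> 1)) // sum1_card card_ord.
apply/and3P; split; rewrite -sumB.
- rewrite (count _ iB) big_mkcond; apply: leq_sum => a _.
  rewrite (bigD1 (Ordinal jB))//=.
  case: ifP => // ai; apply: leq_trans (leq_addr _ _).
  by rewrite (leq_trans lt0)// (plane_partition_col _ ppi).
- rewrite (count _ jB) big_mkcond [leqRHS](bigD1 (Ordinal iB))//=.
  apply: leq_trans (leq_addr _ _); apply: leq_sum => a _; case: ifP => // aj.
  by rewrite (leq_trans lt0)// (plane_partition_row _ ppi).
- rewrite (bigD1 (Ordinal iB))//= (bigD1 (Ordinal jB))//=.
  by rewrite -addnA leq_addr.
Qed.

Lemma finite_plane_overpartitions k n : finite_set (plane_overpartitions k n).
Proof.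
pose box := {ffun 'I_n.+1 * 'I_n.+1 -> 'I_n.+1 * bool}.
pose ext (f : box) : (nat -> nat -> nat) * (nat -> nat -> bool) :=
  (fun i j => if (i < n) && (j < n) then (f (inord i, inord j)).1 : nat else 0,
   fun i j => (i < n) && (j < n) && (f (inord i, inord j)).2).
apply: (@sub_finite_set _ _ (ext @` setT)).
  move=> [pi ov] [/= ppi [ov0 _ _] _].
  exists ([ffun x : 'I_n.+1 * 'I_n.+1 => (inord (pi x.1 x.2), ov x.1 x.2)] : box) => //.
  rewrite /ext; congr pair; apply/funext => i; apply/funext => j; rewrite ffunE/=.
    case: ifPn => [/andP[ni nj]|].
      rewrite !inordK ?ltnS// ?(ltnW ni) ?(ltnW nj)//.
      have [->//|nz] := eqVneq (pi i j) 0.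
      by have /and3P[] := plane_partition_bound ppi nz.
    have [->//|nz] := eqVneq (pi i j) 0.
    by have /and3P[-> ->] := plane_partition_bound ppi nz.
  have [/eqP|nz] := eqVneq (pi i j) 0.
    move=> /eqP/ov0/negbTE e; rewrite e; apply/negbTE/negP.
    case/andP => /andP[ni nj].
    by rewrite !inordK ?ltnS// ?(ltnW ni) ?(ltnW nj)// e.
  have /and3P[ni nj _] := plane_partition_bound ppi nz.
  by rewrite !inordK ?ltnS// ?(ltnW ni) ?(ltnW nj)// ni nj.
by apply: finite_image; exact: finite_finset.
Qed.

(* Main.v *)
Require Import Defs.
From mathcomp Require Import all_boot.
From mathcomp Require Import finmap zify.
From mathcomp Require Import boolp classical_sets cardinality.

Set Implicit Arguments.
Unset Strict Implicit.
Unset Printing Implicit Defensive.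

(** For a plane partition [pi], the overlining rules force every cell except the
    "free" ones: those whose right and upper neighbours carry different entries.
    Free cells may be overlined independently, so the overlinings of a [pi] with
    at least two free cells come in quadruples and vanish modulo 4. Following
    equal entries to the right or upwards from any cell ends at a free cell of
    the same value; hence a [pi] with a single free cell is constant on its
    shape, which contains no 2x2 square (its lower left cell would be forced both
    ways) and so is a hook, and such a [pi] has exactly two overlinings. There are
    [minn k m] hooks of size [m] with at most [k] rows, so the count is
    [2 * \sum_(m %| n) minn k m] modulo 4, and for [k] even only the odd divisors
    [m < k] of [n] matter. All of these divide the least common multiple [l], so
    there are [k./2] of them for [l * n], and for [l * n + p ^ r] they are the
    [r.+1] powers [p ^ i], [i <= r]. *)

Lemma card_fset_set_seq (T : choiceType) (A : set T) (s : seq T) :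
  uniq s -> (forall x, A x <-> x \in s) -> #|` fset_set A| = size s.
Proof.
move=> us As.
have -> : A = [set` [fset x in s]%fset]%classic.
  by apply/funext => x; apply/propext; rewrite /= inE; exact: As.
by rewrite set_fsetK card_fseq undup_id.
Qed.

(** * Free cells and the independent choice of overlines there *)

Definition free_cell (pi : nat -> nat -> nat) (c : nat * nat) : bool :=
  [&& 0 < pi c.1 c.2, pi c.1 c.2.+1 != pi c.1 c.2
    & (c.1 == 0) || (pi c.1.-1 c.2 != pi c.1 c.2)].

Definition set_overline (ov : nat -> nat -> bool) (c : nat * nat) (b : bool) :
    nat -> nat -> bool :=
  fun i j => if (i, j) == c then b else ov i j.

(** By monotonicity, an equal entry further right in the row or further up in the column would make
    the adjacent entry equal too. So at a free cell both rules are vacuous, whatever the value of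
    [b]. *)
Lemma overlining_set n pi ov c b : plane_partition n pi -> free_cell pi c ->
  overlining pi ov -> overlining pi (set_overline ov c b).
Proof.
move=> ppi /and3P[c0 cr cu] [ov0 ovr ovc].
split=> [i j pij|i j j' jj' pij eqp|i i' j ii' pij eqp].
- rewrite /set_overline; case: eqP => [ijc|_]; last exact: ov0.
  by move: c0; rewrite -ijc pij.
- rewrite /set_overline; case: eqP => [ijc|_]; last exact: ovr eqp.
  move: cr; rewrite -ijc /= eqn_leq (plane_partition_row _ ppi) //=.
  by rewrite -eqp (plane_partition_row _ ppi).
- rewrite /set_overline; case: eqP => [ijc|_]; last exact: ovc eqp.
  move: cu; rewrite -ijc /= => /orP[|]; first by move: ii' => /[swap] /eqP ->.
  rewrite eqn_leq [X in _ && X](plane_partition_col _ ppi) ?leq_pred // andbT.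
  by rewrite eqp (plane_partition_col _ ppi) // -ltnS (ltn_predK ii').
Qed.

Definition two_free_cells (pi : nat -> nat -> nat)
    (cd : (nat * nat) * (nat * nat)) : bool :=
  [&& cd.1 != cd.2, free_cell pi cd.1 & free_cell pi cd.2].

Definition multi_free k n : set ((nat -> nat -> nat) * (nat -> nat -> bool)) :=
  (plane_overpartitions k n `&`
   [set x | exists cd, two_free_cells x.1 cd])%classic.

Lemma finite_multi_free k n : finite_set (multi_free k n).
Proof. by apply: finite_setIl; exact: finite_plane_overpartitions. Qed.

Lemma dvdn_card_multi_free k n : 4 %| #|` fset_set (multi_free k n)|.
Proof.
(* The chosen pair of free cells depends on [pi] alone, so resetting overlines does not change the
   choice. *)
have /choice[sel selP] pi : exists cd,
    (exists cd, two_free_cells pi cd) -> two_free_cells pi cd.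
  have [[cd h]|h] := pselect (exists cd, two_free_cells pi cd).
    by exists cd.
  by exists ((0, 0), (0, 0)).
pose g (x : (nat -> nat -> nat) * (nat -> nat -> bool)) (ab : bool * bool) :=
  (x.1, set_overline (set_overline x.2 (sel x.1).1 ab.1) (sel x.1).2 ab.2).
have gM x ab : multi_free k n x -> multi_free k n (g x ab).
  move=> [[pp ol sup] ex]; split=> //; split=> //=.
  have /and3P[_ f1 f2] := selP _ ex.
  by apply: (overlining_set _ pp) => //; exact: (overlining_set _ pp).
(* One representative per quadruple: neither chosen cell is overlined. *)
pose M0 := (multi_free k n `&` [set x | x.2 (sel x.1).1.1 (sel x.1).1.2 = false
   /\ x.2 (sel x.1).2.1 (sel x.1).2.2 = false])%classic.
have finM0 : finite_set M0 by apply: finite_setIl; exact: finite_multi_free.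
have inM0 x : (x \in fset_set M0) <-> M0 x.
  by rewrite (in_fset_set finM0); split=> [/set_mem|/mem_set].
pose s :=
  [seq g x ab | x <- enum_fset (fset_set M0), ab <- enum {: bool * bool}].
rewrite (@card_fset_set_seq _ _ s).
- by rewrite size_allpairs -cardE card_prod !card_bool dvdn_mull.
- apply: allpairs_uniq; [exact: fset_uniq | exact: enum_uniq |].
  move=> [x ab] [y cd] /allpairsP[[x' ab'] /= [xM _ [-> ->]]].
  move=> /allpairsP[[y' cd'] /= [yM _ [-> ->]]] {x y ab cd}.
  move: x' y' ab' cd' xM yM => [pi ov] [pi' ov'] [a b] [c d].
  move=> /inM0[[_ /= ex] [/= o1 o2]] /inM0[_ [/= o1' o2']].
  rewrite /g /= => -[epi]; subst pi'.
  have /and3P[c12 _ _] := selP _ ex.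
  case: (sel pi) c12 o1 o2 o1' o2' => [[i1 j1] [i2 j2]] /= c12 o1 o2 o1' o2' eqf.
  (* The second cell is written last and shows [b]; the first still shows [a] because the two cells
     differ. Elsewhere [ov] is unchanged, and at the two cells both representatives are false. *)
  have E i j := congr1 (fun f => f i j) eqf.
  have eb : b = d by move: (E i2 j2); rewrite /set_overline eqxx.
  have ea : a = c by move: (E i1 j1); rewrite /set_overline (negPf c12) eqxx.
  suff -> : ov = ov' by rewrite ea eb.
  apply/funext => i; apply/funext => j; move: (E i j); rewrite /set_overline.
  case: eqP => [[-> ->]|_]; first by rewrite o2 o2'.
  by case: eqP => [[-> ->]|//]; rewrite o1 o1'.
- move=> [pi ov]; split; last first.
    by move=> /allpairsP[[x ab] /= [/inM0[xM _] _ ->]]; exact: gM.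
  move=> xM; have [_ /= ex] := xM; have /and3P[c12 _ _] := selP _ ex.
  (* Erase the overlines of the two chosen cells and record them as the pair of bits. *)
  apply/allpairsP; exists (g (pi, ov) (false, false),
    (ov (sel pi).1.1 (sel pi).1.2, ov (sel pi).2.1 (sel pi).2.2)); split=> /=.
  + apply/inM0; split; first exact: gM.
    rewrite /= /set_overline; case: (sel pi) c12 => [[? ?] [? ?]] /= /negPf->.
    by rewrite !eqxx.
  + by rewrite mem_enum.
  + rewrite /g /=; congr pair; apply/funext => i; apply/funext => j.
    rewrite /set_overline; case: (sel pi) c12 => [[i1 j1] [i2 j2]] /= c12.
    by case: eqP => [[-> ->] //|_]; case: eqP => [[-> ->]|].
Qed.

(** * Plane partitions with a single free cell, and hooks *)

Lemma exists_free_cell n pi i j : plane_partition n pi -> 0 < pi i j ->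
  exists2 c, free_cell pi c & pi c.1 c.2 = pi i j.
Proof.
(* This measure drops at each step right or up: a positive entry has [j < n], so the subtraction
   does not truncate. *)
move=> ppi; have [N] := ubnP (i + (n - j)).
elim: N i j => // N IH i j leN pij.
have [fc|] := boolP (free_cell pi (i, j)); first by exists (i, j).
rewrite /free_cell /= pij /= negb_and !negbK => /orP[/eqP e|].
  have /and3P[_ jn _] : [&& i < n, j < n & pi i j <= n].
    by apply: plane_partition_bound; rewrite // -lt0n.
  by rewrite -e; apply: IH; [lia | rewrite e].
rewrite negb_or negbK => /andP[i0 /eqP e]; rewrite -e.
by apply: IH; [lia | rewrite e].
Qed.

(* Arm length [a] and leg length [b] exclude the corner: [(a + b).+1] cells. *)
Definition hook_pp (v a b : nat) : nat -> nat -> nat := fun i j =>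
  if (i == 0) && (j <= a) || (j == 0) && (i <= b) then v else 0.

(** The column rule overlines the whole leg, and the row rule forbids overlines in row 0 before the
    end of the arm. That end is the free cell, with overline [f]; it is the corner when [a = 0]. *)
Definition hook_ov (a b : nat) (f : bool) : nat -> nat -> bool := fun i j =>
  (j == 0) && (0 < i <= b) || [&& i == 0, j == a & f].

Lemma sum_hook_pp v a b B : a < B -> b < B ->
  \sum_(i < B) \sum_(j < B) hook_pp v a b i j = (a + b).+1 * v.
Proof.
case: B => // B aB bB; rewrite big_ord_recl /=.
have row0 : \sum_(j < B.+1) hook_pp v a b 0 j = a.+1 * v.
  rewrite -[a.+1 in RHS]subn0 -sum_nat_const_nat -(big_mkord xpredT (hook_pp v a b 0)).
  rewrite (big_cat_nat (n := a.+1)) //= [X in _ + X]big_nat_cond [X in _ + X]big1 ?addn0.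
    by apply: eq_big_nat => j; rewrite /hook_pp /= ltnS => ->.
  by move=> j; rewrite /hook_pp /= andbT => /andP[aj _]; rewrite leqNgt aj; case: j aj.
have col0 : \sum_(i < B) \sum_(j < B.+1) hook_pp v a b (bump 0 i) j = b * v.
  transitivity (\sum_(0 <= i < B) if i < b then v else 0).
    rewrite big_mkord; apply: eq_bigr => i _; rewrite big_ord_recl /=.
    rewrite big1 ?addn0 => [|j _]; first by rewrite /hook_pp /=.
    by rewrite /hook_pp.
  rewrite (big_cat_nat (n := b)) //= [X in _ + X]big_nat_cond [X in _ + X]big1 ?addn0.
    rewrite -[b in RHS]subn0 -sum_nat_const_nat.
    by apply: eq_big_nat => j /andP[_ ->].
  by move=> j; rewrite andbT => /andP[bj _]; rewrite ltnNge bj.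
by rewrite row0 col0 -mulnDl.
Qed.

Lemma hook_overpartition k n v a b f : 0 < v -> b < k -> (a + b).+1 * v = n ->
  plane_overpartitions k n (hook_pp v a b, hook_ov a b f).
Proof.
move=> v0 bk vn; split=> /=.
- split=> [i j|i j|]; try by rewrite /hook_pp; do 2 case: ifP => //; lia.
  exists (a + b).+1; last by rewrite sum_hook_pp // ltnS ?leq_addr ?leq_addl.
  by move=> i j; rewrite /hook_pp; case: ifP => //; lia.
- split=> [i j|i j j'|i i' j]; rewrite /hook_pp /hook_ov.
  + by case: ifP => //; lia.
  + by case: f; do 2 case: ifP => //; lia.
  + by case: f; do 2 case: ifP => //; lia.
- by move=> i j ki; rewrite /hook_pp; case: ifP => //; lia.
Qed.

Lemma free_cell_hook v a b c : free_cell (hook_pp v a b) c -> c = (0, a).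
Proof.
case: c => i j; rewrite /free_cell /hook_pp /= => h.
suff [-> ->] : i = 0 /\ j = a by [].
by move: h; do 3 case: ifP => //; lia.
Qed.

Lemma single_free_hook k n pi ov : 0 < n -> plane_overpartitions k n (pi, ov) ->
    ~ (exists cd, two_free_cells pi cd) ->
  exists v a b f, [/\ 0 < v, b < k, (a + b).+1 * v = n, pi = hook_pp v a b
                   & ov = hook_ov a b f].
Proof.
move=> n0 [/= ppi [ov0 ovr ovc] sup] nex.
have [_ _ [B supB sumB]] := ppi.
have le00 i j : pi i j <= pi 0 0.
  rewrite (leq_trans (plane_partition_row i ppi (leq0n j))) //.
  by rewrite (plane_partition_col _ ppi).
have v0 : 0 < pi 0 0.
  rewrite lt0n; apply/eqP => p00; move: n0; rewrite -sumB big1 // => i _.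
  by rewrite big1 // => j _; apply/eqP; rewrite -leqn0 -p00.
(* Each positive value occurs at a free cell, and there is only one such cell. *)
have valE i j : 0 < pi i j -> pi i j = pi 0 0.
  move=> pij; have [c fc <-] := exists_free_cell ppi pij.
  have [d fd <-] := exists_free_cell ppi v0.
  have [->//|cd] := eqVneq c d.
  by case: nex; exists (c, d); rewrite /two_free_cells cd fc fd.
(* Otherwise cell (1, 0) must be overlined, having an equal entry above, and must not be, having an
   equal entry to its right. *)
have p11 : pi 1 1 = 0.
  apply/eqP; rewrite -leqn0 leqNgt; apply/negP => p11.
  have p10 : 0 < pi 1 0 by rewrite (leq_trans p11) // (plane_partition_row _ ppi).
  have := ovc 0 1 0 isT v0 (valE _ _ p10).
  by apply/negP/(ovr 1 0 1) => //; rewrite (valE _ _ p11) (valE _ _ p10).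
have exa : exists j, pi 0 j == 0.
  by exists B; apply/negPn/negP => /supB; rewrite ltnn andbF.
have exb : exists i, pi i 0 == 0.
  by exists B; apply/negPn/negP => /supB; rewrite ltnn.
(* The first zero of row 0 is in column [a.+1], so [a] counts the arm without the corner; likewise
   for [b] in column 0. *)
case: (ex_minnP exa) => -[|a] /eqP pa mina; first by move: v0; rewrite pa.
case: (ex_minnP exb) => -[|b] /eqP pb minb; first by move: v0; rewrite pb.
have row0 j : pi 0 j = if j <= a then pi 0 0 else 0.
  case: leqP => ja.
    by apply: valE; rewrite lt0n; apply/negP => /mina; rewrite ltnNge ja.
  by have := plane_partition_row 0 ppi ja; rewrite pa leqn0 => /eqP.
have col0 i : pi i 0 = if i <= b then pi 0 0 else 0.
  case: leqP => ib.
    by apply: valE; rewrite lt0n; apply/negP => /minb; rewrite ltnNge ib.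
  by have := plane_partition_col 0 ppi ib; rewrite pb leqn0 => /eqP.
have piE : pi = hook_pp (pi 0 0) a b.
  apply/funext => i; apply/funext => j; rewrite /hook_pp.
  case: i => [|i].
    by rewrite /= row0; case: j => [|j]; rewrite ?leq0n ?orbF ?andbT /=.
  case: j => [|j]; first by rewrite /= col0.
  apply/eqP; rewrite /= -leqn0 -[leqRHS]p11.
  rewrite (leq_trans (plane_partition_row i.+1 ppi (ltn0Sn j))) //.
  by rewrite (plane_partition_col _ ppi).
have /andP[_ aB] : (0 < B) && (a < B) by apply: supB; rewrite row0 leqnn -lt0n.
have /andP[bB _] : (b < B) && (0 < B) by apply: supB; rewrite col0 leqnn -lt0n.
exists (pi 0 0), a, b, (ov 0 a); split=> //.
- rewrite ltnNge; apply/negP => kb; move: (sup b 0 kb); rewrite col0 leqnn => p00.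
  by rewrite p00 in v0.
- rewrite -sumB -(@sum_hook_pp _ _ _ B) //.
  by apply: eq_bigr => i _; apply: eq_bigr => j _; rewrite -piE.
- apply/funext => i; apply/funext => j.
  have [pij|pij] := eqVneq (pi i j) 0.
    rewrite (negPf (ov0 _ _ pij)); apply/esym/negbTE; move: pij.
    rewrite piE /hook_pp /hook_ov; case: ifP; last lia.
    by move=> _ p00; rewrite p00 in v0.
  case: i pij => [|i] pij; rewrite /hook_ov ?andbF /=.
    have [->//|ja] := eqVneq j a.
    have ltja : j < a.
      by rewrite ltn_neqAle ja /=; move: pij; rewrite row0; case: leqP.
    apply/negbTE/(ovr 0 j a); rewrite ?lt0n //.
    by rewrite (row0 a) (row0 j) leqnn ltnW.
  case: j pij => [|j] pij /=; rewrite ?orbF.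
    move: pij; rewrite col0; case: leqP => // ib _.
    by rewrite (ovc 0 i.+1 0) // col0 ib.
  by move: pij; rewrite piE /hook_pp.
Qed.

Lemma hook_inj a b f a' b' f' v v' : 0 < v -> 0 < v' ->
  (hook_pp v a b, hook_ov a b f) = (hook_pp v' a' b', hook_ov a' b' f') ->
  [/\ v = v', a = a', b = b' & f = f'].
Proof.
move=> v0 v'0 [/(congr1 (fun p => p^~ _)) eqp /(congr1 (fun p => p^~ _)) eqo].
have P i j : hook_pp v a b i j = hook_pp v' a' b' i j :=
  congr1 (fun p => p i) (eqp j).
have O i j : hook_ov a b f i j = hook_ov a' b' f' i j :=
  congr1 (fun p => p i) (eqo j).
have ev : v = v' by have := P 0 0; rewrite /hook_pp.
subst v'.
have ea : a = a'.
  have := P 0 a; have := P 0 a'; rewrite /hook_pp /= !leqnn /=.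
  by do 2 case: ifP => //; lia.
have eb : b = b'.
  have := P b 0; have := P b' 0; rewrite /hook_pp !leqnn !orbT /=.
  by do 2 case: ifP => //; lia.
split=> //; subst a' b'; have := O 0 a; rewrite /hook_ov /= !eqxx.
by rewrite /= ?andbF.
Qed.

(** * Reduction modulo 4 to a divisor sum *)

Lemma plbar_mod4 k n : 0 < n ->
  plbar k n = 2 * \sum_(m <- divisors n) minn k m %[mod 4].
Proof.
move=> n0; rewrite /plbar.
set X := plane_overpartitions k n.
have finX : finite_set X by exact: finite_plane_overpartitions.
have -> : #|` fset_set X| =
    #|` fset_set (multi_free k n)| + #|` fset_set (X `\` multi_free k n)|.
  have finM := finite_multi_free k n.
  rewrite fset_setD // -(cardfsID (fset_set (multi_free k n)) (fset_set X)).
  congr (_ + _); rewrite -fset_setI //; congr #|` fset_set _|.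
  by apply/seteqP; split=> x; [case | move=> []; split].
(* A hook is coded by its size [m] and leg length [b]: the common entry is then [n %/ m] and the arm
   length [(m - b).-1]. The bound [minn k m] says that the leg fits in both [k] rows and [m]
   cells. *)
pose D := [seq (m, b) | m <- divisors n, b <- iota 0 (minn k m)].
pose h (x : nat * nat) (f : bool) :=
  (hook_pp (n %/ x.1) (x.1 - x.2).-1 x.2, hook_ov (x.1 - x.2).-1 x.2 f).
have DP m b : reflect [/\ m %| n, b < k & b < m] ((m, b) \in D).
  apply: (iffP idP) => [/allpairsPdep[m' [b' [+ + [-> ->]]]]|[mn bk bm]].
    by rewrite -dvdn_divisors // mem_iota leq0n add0n leq_min => ? /and3P[].
  apply: allpairs_f_dep; rewrite -?dvdn_divisors //.
  by rewrite mem_iota leq0n add0n leq_min bk.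
have Dpos m b : (m, b) \in D -> 0 < n %/ m.
  by case/DP => mn _ _; rewrite divn_gt0 ?(dvdn_gt0 n0 mn) // dvdn_leq.
rewrite (@card_fset_set_seq _ (X `\` multi_free k n)%classic
           [seq h x f | x <- D, f <- enum {: bool}]).
- rewrite -modnDml (eqP (dvdn_card_multi_free k n)) add0n size_allpairs -cardE card_bool mulnC.
  rewrite size_allpairs_dep sumnE big_map.
  by under eq_bigr do rewrite size_iota.
- apply: allpairs_uniq; [|exact: enum_uniq|].
    apply: allpairs_uniq_dep; first exact: divisors_uniq.
      by move=> *; exact: iota_uniq.
    by move=> [m b] [m' b'] _ _ [-> ->].
  move=> [x f] [y g] /allpairsP[[[m b] f'] /= [mD _ [-> ->]]].
  move=> /allpairsP[[[m' b'] g'] /= [mD' _ [-> ->]]] {x y f g}.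
  move=> /(hook_inj (Dpos _ _ mD) (Dpos _ _ mD'))[/= ev ea eb ->].
  have [mn _ bm] := DP _ _ mD; have [mn' _ bm'] := DP _ _ mD'.
  by subst b'; congr ((_, _), _); lia.
- move=> [pi ov]; split.
    move=> [xX nM]; have nex : ~ (exists cd, two_free_cells pi cd).
      by move=> ex; apply: nM.
    have [v [a [b [f [v0 bk vn -> ->]]]]] := single_free_hook n0 xX nex.
    apply/allpairsP; exists (((a + b).+1, b), f); split=> /=.
    + by apply/DP; split=> //; [rewrite -vn dvdn_mulr | rewrite ltnS leq_addl].
    + by rewrite mem_enum.
    + by rewrite /h /= -vn mulKn // subSn ?leq_addl // addnK.
  move=> /allpairsP[[[m b] f] /= [mD _ ->]]; have [mn bk bm] := DP _ _ mD.
  split; last first.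
    move=> [_ [[c d] /and3P[/= cd /free_cell_hook cE /free_cell_hook dE]]].
    by move: cd; rewrite cE dE eqxx.
  apply: hook_overpartition => //; first exact: Dpos mD.
  by rewrite /= -[RHS](divnK mn) mulnC; congr (_ * _); lia.
Qed.


(** * Arithmetic of the least common multiple *)

Lemma dvdn_lcm_odd_below k m : odd m -> m < k -> m %| lcm_odd_below k.
Proof.
move=> om mk; have m0 := odd_gt0 om.
rewrite /lcm_odd_below (big_cat_nat (n := m)) ?(ltnW mk) //=.
rewrite [X in lcmn _ X]big_ltn_cond // om.
by rewrite (dvdn_trans (dvdn_lcml _ _) (dvdn_lcmr _ _)).
Qed.

Lemma biglcmn_gt0 (s : seq nat) (P : pred nat) :
  {in s, forall j, P j -> 0 < j} -> 0 < \big[lcmn/1]_(j <- s | P j) j.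
Proof.
move=> s0; rewrite big_seq_cond; elim/big_rec: _ => // j x /andP[js Pj] x0.
by rewrite lcmn_gt0 x0 (s0 j).
Qed.

(** The valuation of a least common multiple is the maximum of the valuations, hence attained by one
    term; [0 < r] rules out the empty case. *)
Lemma logn_biglcmn_leq (p r : nat) (s : seq nat) (P : pred nat) :
    0 < r -> {in s, forall j, P j -> 0 < j} ->
    r <= logn p (\big[lcmn/1]_(j <- s | P j) j) ->
  exists j, [/\ j \in s, P j & r <= logn p j].
Proof.
move=> r0; elim: s => [|x s IH] s0; first by rewrite big_nil logn1; lia.
have {}IH : r <= logn p (\big[lcmn/1]_(j <- s | P j) j) ->
    exists j, [/\ j \in x :: s, P j & r <= logn p j].
  move=> /IH[j js|j [js Pj rj]]; first by apply: s0; rewrite inE js orbT.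
  by exists j; rewrite inE js orbT.
rewrite big_cons; case: ifP => // Px.
have x0 : 0 < x by apply: s0; rewrite // inE eqxx.
rewrite logn_lcm //; last first.
  by apply: biglcmn_gt0 => j js; apply: s0; rewrite inE js orbT.
by rewrite leq_max => /orP[rx|//]; exists x; rewrite inE eqxx.
Qed.

Lemma lcm_odd_below_gt0 k : 0 < lcm_odd_below k.
Proof. by apply: biglcmn_gt0 => j _; exact: odd_gt0. Qed.

(** Some odd [j < k] is itself divisible by [p ^ r]. *)
Lemma pfactor_lcm_odd_below_lt k p r : 0 < r ->
  r <= logn p (lcm_odd_below k) -> p ^ r < k.
Proof.
move=> r0 /(logn_biglcmn_leq r0)[j _|j [+ oj rj]]; first exact: odd_gt0.
rewrite mem_index_iota => /andP[_]; apply: leq_ltn_trans.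
have j0 := odd_gt0 oj; apply: dvdn_leq => //.
by apply: dvdn_trans (pfactor_dvdnn p j); exact: dvdn_exp2l.
Qed.

(** * Odd divisors below [k] *)

Definition small_odd_divisors k n :=
  [seq m <- divisors n | odd m && (m < k)].

(** Modulo 4, [2 * minn k m] depends only on the parity of [minn k m], and for [k] even this minimum
    is odd exactly when [m] is odd and below [k]. *)
Lemma plbar_even_mod4 k n : ~~ odd k -> 0 < n ->
  plbar k n = 2 * size (small_odd_divisors k n) %[mod 4].
Proof.
move=> ke n0; rewrite plbar_mod4 // size_filter -sum1_count [in RHS]big_mkcond /=.
elim: (divisors n) => [|m s IH]; first by rewrite !big_nil.
rewrite !big_cons !mulnDr -modnDmr IH modnDmr.
apply/eqP; rewrite eqn_modDr; apply/eqP.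
have oddE : odd (minn k m) = odd m && (m < k).
  by rewrite minnC; case: ltnP => km; [rewrite andbT | rewrite (negPf ke) andbF].
rewrite -[minn k m]odd_double_half oddE mulnDr -mul2n mulnA addnC
  (mulnC (2 * 2)) modnMDl.
by case: ifP.
Qed.

Lemma mem_small_odd_divisors k n m : 0 < n ->
  (m \in small_odd_divisors k n) = [&& odd m, m < k & m %| n].
Proof. by move=> n0; rewrite mem_filter -dvdn_divisors // -andbA. Qed.

Lemma count_odd_iota k : count odd (iota 0 k) = k./2.
Proof.
elim: k => // k IH.
by rewrite -addn1 iotaD count_cat IH addn1 /= uphalf_half; lia.
Qed.

Lemma size_small_odd_divisors_mul k n : 0 < n ->
  size (small_odd_divisors k (lcm_odd_below k * n)) = k./2.
Proof.
move=> n0; rewrite -count_odd_iota -size_filter; apply/perm_size/uniq_perm.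
- exact/filter_uniq/divisors_uniq.
- exact/filter_uniq/iota_uniq.
move=> m; rewrite mem_small_odd_divisors ?muln_gt0 ?lcm_odd_below_gt0 //.
rewrite mem_filter mem_iota /=; case: (boolP (odd m)) => //= om.
by case: ltnP => //= mk; rewrite dvdn_mulr // dvdn_lcm_odd_below.
Qed.

(** An odd [m < k] divides the least common multiple, so it divides the sum exactly when it divides
    [p ^ r]. Conversely every [p ^ i] with [i <= r] counts, since [p ^ r < k]. *)
Lemma size_small_odd_divisors_add k p r n : prime p -> odd p -> 0 < r ->
    r <= logn p (lcm_odd_below k) ->
  size (small_odd_divisors k (lcm_odd_below k * n + p ^ r)) = r.+1.
Proof.
move=> pp op r0 rl; have prk := pfactor_lcm_odd_below_lt r0 rl.
rewrite -[RHS](size_iota 0) -[RHS](size_map (expn p)); apply/perm_size/uniq_perm.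
- exact/filter_uniq/divisors_uniq.
- by rewrite map_inj_uniq ?iota_uniq //; exact: expnI (prime_gt1 pp).
move=> m; rewrite mem_small_odd_divisors ?addn_gt0 ?expn_gt0 ?(prime_gt0 pp) ?orbT //.
apply/and3P/mapP => [[om mk]|[i]].
  rewrite dvdn_addr ?dvdn_mulr ?dvdn_lcm_odd_below //.
  move=> /(dvdn_pfactor _ _ pp)[i ir ->].
  by exists i; rewrite // mem_iota.
rewrite mem_iota ltnS => /andP[_ ir] ->.
have oi : odd (p ^ i) by rewrite oddX op orbT.
have ik : p ^ i < k by apply: leq_ltn_trans prk; rewrite leq_exp2l ?prime_gt1.
by split=> //; rewrite dvdn_add ?dvdn_exp2l // dvdn_mulr // dvdn_lcm_odd_below.
Qed.

Theorem theorem1p5 (k : nat) (hk : 2 <= k) (keven : ~~ odd k) :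
  (forall p r n : nat, prime p -> odd p -> p < k ->
     1 <= r -> r <= logn p (lcm_odd_below k) -> 1 <= n ->
     (odd r -> plbar k (lcm_odd_below k * n + p ^ r) = 0 %[mod 4]) /\
     (~~ odd r -> plbar k (lcm_odd_below k * n + p ^ r) = 2 %[mod 4])) /\
  (forall n : nat, 1 <= n ->
     (k = 0 %[mod 4] -> plbar k (lcm_odd_below k * n) = 0 %[mod 4]) /\
     (k = 2 %[mod 4] -> plbar k (lcm_odd_below k * n) = 2 %[mod 4])).
Proof.
split=> [p r n pp op _ r0 rl n0|n n0].
  rewrite plbar_even_mod4 ?addn_gt0 ?expn_gt0 ?(prime_gt0 pp) ?orbT //.
  by rewrite size_small_odd_divisors_add //; split; lia.
rewrite plbar_even_mod4 ?muln_gt0 ?lcm_odd_below_gt0 //.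
(* For [k] even, [2 * k./2] is [k] itself. *)
by rewrite size_small_odd_divisors_mul //; split; lia.
Qed.
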